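(* Let $\mathcal{H}$ be a real Hilbert space, let $\theta\in(0,1]$, and let $T:\mathcal{H}\to\mathcal{H}$ be a $\theta$-averaged operator. Let $\alpha>2$, $x_0,x_1\in\mathcal{H}$, $0<s\le \frac1\theta$, and let $(x_k)_{k\ge0}$ be the sequence generated by the Fast KM algorithm, i.e. for every $k\ge1$ $$x_{k+1}:=\left(1-\frac{s\alpha}{2(k+\alpha)}\right)x_k+\frac{(1-s)k}{k+\alpha}(x_k-x_{k-1})+\frac{s\alpha}{2(k+\alpha)}T(x_k)+\frac{sk}{k+\alpha}\bigl(T(x_k)-T(x_{k-1})\bigr).$$ Then $$\|x_k-x_{k-1}\|=o\left(\frac1k\right)\quad\text{and}\quad \|x_{k-1}-T(x_{k-1})\|=o\left(\frac1k\right)\quad\text{as }k\to+\infty.$$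
   Context: An operator $R:\mathcal{H}\to\mathcal{H}$ is nonexpansive if $\|R(x)-R(y)\|\le\|x-y\|$ for all $x,y\in\mathcal{H}$. For $\theta\in(0,1]$, $T:\mathcal{H}\to\mathcal{H}$ is $\theta$-averaged if there is a nonexpansive $R:\mathcal{H}\to\mathcal{H}$ with $T=(1-\theta)\mathrm{Id}+\theta R$, where $\mathrm{Id}$ is the identity on $\mathcal{H}$. For a real sequence $(a_k)$, $a_k=o(1/k)$ means $k\,a_k\to0$ as $k\to+\infty$.
   Formalization: The formal theorem additionally assumes that T has a fixed point; without this the claim fails, e.g. for T(x) = x + 1 on the real line with θ = s = 1 and x_k = k/2. *)

(* Defs.v *)
From HB Require Import structures.
From mathcomp Require Import all_boot all_order all_algebra.
From mathcomp Require Import all_classical all_reals all_analysis.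

Set Implicit Arguments.
Unset Strict Implicit.
Unset Printing Implicit Defensive.

Import Order.TTheory GRing.Theory Num.Theory.
Import numFieldNormedType.Exports.

Local Open Scope classical_set_scope.
Local Open Scope ring_scope.

(* A real Hilbert space is a complete normed module [H] over [R : realType]
   together with an inner product [ip : {dot H for idfun}] (a symmetric,
   positive definite bilinear form) that induces the norm of [H]. *)
Definition induces_norm (R : realType) (H : normedModType R)
    (ip : {dot H for idfun}) : Prop :=
  forall x : H, `|x| ^+ 2 = ip x x.

Definition nonexpansive (R : realType) (H : normedModType R)
    (F : H -> H) : Prop :=
  forall x y : H, `|F x - F y| <= `|x - y|.

Definition averaged (R : realType) (H : normedModType R)
    (theta : R) (T : H -> H) : Prop :=
  exists F : H -> H, nonexpansive F /\
    forall x : H, T x = (1 - theta) *: x + theta *: F x.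

(* The starting points [x 0] and [x 1] are arbitrary. *)
Definition fast_KM (R : realType) (H : normedModType R)
    (alpha s : R) (T : H -> H) (x : nat -> H) : Prop :=
  forall k : nat, (1 <= k)%N ->
    x k.+1 =
      (1 - s * alpha / (2 * (k%:R + alpha))) *: x k
      + ((1 - s) * k%:R / (k%:R + alpha)) *: (x k - x k.-1)
      + (s * alpha / (2 * (k%:R + alpha))) *: T (x k)
      + (s * k%:R / (k%:R + alpha)) *: (T (x k) - T (x k.-1)).

(* [a k = o(1/k)]; the value of [a 0] is irrelevant. *)
Definition little_o_inv (R : realType) (a : nat -> R) : Prop :=
  k%:R * a k @[k --> \oo] --> (0 : R).

(* Main.v *)
(** Put [S := (1 - s) Id + s T], which is nonexpansive because [s theta <= 1],
    [b k := x k - S (x k)], [v k := x k - x k.-1], [u k := v k + b k.-1] and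
    [l := alpha / 2 > 1]. The recursion is equivalent to each of
      [(k + l) u (k+1) + l v (k+1) = k u k],
      [(k + l) v (k+1) + l u (k+1) = k (S (x k) - S (x (k-1)))].
    For a fixed point [p] of [S] and [z k := x k - p], the energy
    [|k u k + l z k|^2 + l (l - 1) |z k|^2] decreases by at least
    [2 (l - 1) (k+1) |u (k+1)|^2], so [k |u k|^2] is summable. As
    [|S (x k) - S (x (k-1))| <= |v k|], the second recursion bounds the growth of
    [k^2 |v k|^2] by a multiple of [k |u k|^2]; hence [k |v k|^2] is summable and
    [k^2 |v k|^2] converges, necessarily to 0. The first recursion then gives
    [k |u k| --> 0] in the same way, and [b k.-1 = u k - v k]. *)
Require Import Defs.
From HB Require Import structures.
From mathcomp Require Import all_boot all_order all_algebra.
From mathcomp Require Import all_classical all_reals all_analysis.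
From mathcomp Require Import ring lra.

Set Implicit Arguments.
Unset Strict Implicit.

Import Order.TTheory GRing.Theory Num.Theory.
Import numFieldNormedType.Exports.
Local Open Scope classical_set_scope.
Local Open Scope ring_scope.

(** * Real sequences that decrease up to summable errors *)

Lemma series_cvg_of_decrease (R : realType) (V e : nat -> R) :
  (forall n, 0 <= V n) -> (forall n, 0 <= e n) ->
  (forall n, V n.+1 + e n <= V n) -> cvgn (series e).
Proof.
move=> V0 e0 Ve.
apply: nondecreasing_is_cvgn; first by apply: nondecreasing_series => n _ _.
have le n : V n + series e n <= V 0%N.
  elim: n => [|n IH]; first by rewrite /series/= big_geq// addr0.
  rewrite /series/= big_nat_recr//=; move: IH; rewrite /series/=.
  have := Ve n; lra.
exists (V 0%N) => _ [n _ <-]; have := le n; have := V0 n; lra.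
Qed.

Lemma near_series_le_cvg (R : realType) (u v : nat -> R) :
  (forall n, 0 <= u n) -> (forall n, 0 <= v n) ->
  (\forall n \near \oo, u n <= v n) -> cvgn (series v) -> cvgn (series u).
Proof.
move=> u0 v0 [N _ uv] cv.
have ndu : nondecreasing_seq (series u) by apply: nondecreasing_series => n _ _.
have ndv : nondecreasing_seq (series v) by apply: nondecreasing_series => n _ _.
have le n : series u n <= series u N + series v n.
  elim: n => [|n IH].
    rewrite {1 3}/series/= !big_geq// addr0.
    by have := ndu 0%N N isT; rewrite {1}/series/= big_geq.
  have [ltnN|leNn] := ltnP n N.
    have := ndu _ _ ltnN; have : 0 <= series v n.+1.
      by rewrite /series/= sumr_ge0.
    lra.
  have := uv n leNn; move: IH; rewrite /series/= !(big_nat_recr n)//=; lra.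
apply: nondecreasing_is_cvgn => //.
exists (series u N + limn (series v)) => _ [n _ <-].
by apply: le_trans (le n) _; rewrite lerD2l nondecreasing_cvgn_le.
Qed.

(** The errors are summable, so [A] minus their partial sums is nonincreasing and bounded below, and
    [A] converges. The dissipated terms form a convergent series, which forces the limit to be 0. *)
Lemma quasi_decreasing_cvg0 (R : realType) (delta : R) (A e : nat -> R) :
  0 < delta -> (forall n, 0 <= A n) -> (forall n, 0 <= e n) ->
  cvgn (series e) ->
  (forall n, A n.+1 + delta * (A n.+1 / n.+2%:R) <= A n + e n) ->
  A n @[n --> \oo] --> (0 : R) /\ cvgn (series (fun n => A n.+1 / n.+2%:R)).
Proof.
move=> d0 A0 e0 ce Ae.
have nde : nondecreasing_seq (series e) by apply: nondecreasing_series => n _ _.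
have f0 n : 0 <= A n.+1 / n.+2%:R by rewrite divr_ge0.
have seS n : series e n.+1 = series e n + e n.
  by rewrite /series/= big_nat_recr.
have cA : cvgn (series (fun n => A n.+1 / n.+2%:R)).
  have : cvgn (series (fun n => delta * (A n.+1 / n.+2%:R))).
    (* Adding the tail of the error series to [A] gives a truly decreasing quantity. *)
    apply: (@series_cvg_of_decrease _
        (fun n => A n + (limn (series e) - series e n))) => n.
    - by rewrite addr_ge0// subr_ge0 nondecreasing_cvgn_le.
    - by rewrite mulr_ge0// ltW.
    - rewrite seS; move: (Ae n); move: (delta * _) => f; lra.
  move/(@is_cvg_seriesZ _ _ delta^-1).
  have -> : delta^-1 *: (fun n => delta * (A n.+1 / n.+2%:R)) =
      (fun n => A n.+1 / n.+2%:R).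
    by apply/funext => n; rewrite scalrfctE; exact: (mulKf (lt0r_neq0 d0)).
  by [].
split=> //.
have cD : cvgn (fun n => A n - series e n).
  apply: nonincreasing_is_cvgn.
    apply/nonincreasing_seqP => n.
    have := Ae n; have := mulr_ge0 (ltW d0) (f0 n); rewrite seS.
    move: (delta * _) => f; lra.
  exists (- limn (series e)) => _ [n _ <-].
  have := A0 n; have := nondecreasing_cvgn_le nde ce n; lra.
have cvA : cvgn A.
  have -> : A = (fun n => A n - series e n) \+ series e.
    by apply/funext => n /=; rewrite subrK.
  exact: is_cvgD.
have L0 : 0 <= limn A by apply: limr_ge => //; apply: nearW.
have [L_gt0|L_le0] := ltP 0 (limn A); last first.
  by have <- : limn A = 0 by apply/eqP; rewrite eq_le L0 L_le0.
(* A positive limit would make the summable [A n.+1 / n.+2] comparable to the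
   harmonic series. *)
exfalso; apply: (@dvg_harmonic R).
(* Eventually [A n.+1] exceeds half its limit, so the factor 4 leaves at least 2, which dominates
   [n.+2 / n.+1]. *)
have c4 : cvgn (series (fun n => (4 / limn A) * (A n.+1 / n.+2%:R))).
  exact: (@is_cvg_seriesZ _ _ (4 / limn A) cA).
apply: near_series_le_cvg c4 => [n|n|]; first exact: harmonic_ge0.
  by rewrite mulr_ge0// divr_ge0// ltW.
have /cvgr_gt/(_ (limn A / 2)) : A n.+1 @[n --> \oo] --> limn A.
  by rewrite -cvg_shiftS in cvA *.
have lt2 : limn A / 2 < limn A by lra.
move/(_ lt2); apply: filterS => n An.
rewrite /harmonic/=.
have -> : 4 / limn A * (A n.+1 / n.+2%:R) = (4 * A n.+1 / limn A) / n.+2%:R.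
  by rewrite mulrA (mulrAC 4).
have n1 : 0 < n.+1%:R :> R by rewrite ltr0n.
have n2 : 0 < n.+2%:R :> R by rewrite ltr0n.
have h2 : 2 <= 4 * A n.+1 / limn A by rewrite ler_pdivlMr//; lra.
rewrite ler_pdivlMr//; apply: le_trans h2.
rewrite mulrC ler_pdivrMr//.
have -> : n.+2%:R = n.+1%:R + 1 :> R by rewrite -natr1.
have : 1 <= n.+1%:R :> R by rewrite ler1n.
lra.
Qed.

(** * Energy estimates in the Hilbert space *)

Section InnerProduct.

Context (R : realType) (H : normedModType R) (ip : {dot H for idfun}).
Hypothesis hip : induces_norm ip.

Lemma ipC (a b : H) : ip a b = ip b a.
Proof. by rewrite hermC/= expr0 mul1r. Qed.

Lemma ipDl (a b w : H) : ip (a + b) w = ip a w + ip b w.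
Proof. exact: linearDl. Qed.

Lemma ipNl (a w : H) : ip (- a) w = - ip a w.
Proof. exact: linearNl. Qed.

Lemma ipZl (c : R) (a w : H) : ip (c *: a) w = c * ip a w.
Proof. exact: linearZl_LR. Qed.

(** Turns vector identities into scalar ones, which [field] can decide. *)
Lemma ip_inj (a b : H) : (forall w, ip a w = ip b w) -> a = b.
Proof.
move=> ab; apply/eqP; rewrite -subr_eq0 -normr_eq0 -sqrf_eq0 hip.
by rewrite ipDl ipNl ab subrr.
Qed.

Lemma sqnorm_lincomb (c d : R) (a b : H) :
  `|c *: a + d *: b| ^+ 2 =
  c ^+ 2 * `|a| ^+ 2 + 2 * (c * d) * ip a b + d ^+ 2 * `|b| ^+ 2.
Proof.
rewrite !hip ipDl !ipZl !(ipC _ (c *: a + _)) !ipDl !ipZl (ipC b a); ring.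
Qed.

Lemma ip_young (a b : H) (c : R) : 0 < c ->
  - (c * `|a| ^+ 2 + c^-1 * `|b| ^+ 2) <= 2 * ip a b.
Proof.
move=> c0; have ci0 : 0 <= c^-1 by rewrite invr_ge0 ltW.
have := mulr_ge0 ci0 (exprn_ge0 2 (normr_ge0 (c *: a + 1 *: b))).
rewrite sqnorm_lincomb.
rewrite !mulrDr.
have -> : c^-1 * (c ^+ 2 * `|a| ^+ 2) = c * `|a| ^+ 2.
  by field; rewrite gt_eqF.
have -> : c^-1 * (2 * (c * 1) * ip a b) = 2 * ip a b by field; rewrite gt_eqF.
lra.
Qed.

(** Squaring the hypothesis and bounding the cross term by Young's inequality shows that
    [(k |p k|)^2] decreases up to a multiple of [k |q k|^2]. The hypothesis form covers both
    recursions, with the roles of [u] and [v] exchanged. *)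
Lemma coupled_decay (l : R) (p q : nat -> H) : 1 < l ->
  (forall k, (0 < k)%N ->
    `|(k%:R + l) *: p k.+1 + l *: q k.+1| <= `|k%:R *: p k|) ->
  cvgn (series (fun n => n.+2%:R * `|q n.+2| ^+ 2)) ->
  k%:R * `|p k| @[k --> \oo] --> (0 : R) /\
  cvgn (series (fun n => n.+2%:R * `|p n.+2| ^+ 2)).
Proof.
move=> l1 hpq cq.
(* Young's inequality contributes [l ^+ 2 / (l - 1) * (K + l)] in front of [Q]; the third power of
   [l] comes from [K + l <= l * (K + 1)]. *)
pose C := l ^+ 3 / (l - 1).
have C0 : 0 < C by rewrite divr_gt0 ?exprn_gt0//; lra.
have [|||||] := @quasi_decreasing_cvg0 _ (l - 1)
    (fun n => (n.+1%:R * `|p n.+1|) ^+ 2)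
    (fun n => C * (n.+2%:R * `|q n.+2| ^+ 2)).
- lra.
- by move=> n; rewrite exprn_ge0// mulr_ge0.
- by move=> n; rewrite mulr_ge0 ?(ltW C0)// mulr_ge0// exprn_ge0.
- exact: (@is_cvg_seriesZ _ _ C cq).
- move=> n; have := hpq n.+1 isT.
  rewrite -(ler_pXn2r (n := 2))// ?nnegrE// !exprMn.
  rewrite normrZ ger0_norm// exprMn => h.
  have nK : n.+2%:R = n.+1%:R + 1 :> R by rewrite -natr1.
  have K0 : 0 < n.+1%:R :> R by rewrite ltr0n.
  move: h; rewrite nK; move: (n.+1%:R) K0 => K K0.
  pose P : R := `|p n.+2| ^+ 2; pose Q : R := `|q n.+2| ^+ 2.
  have Q0 : 0 <= Q by rewrite exprn_ge0.
  rewrite sqnorm_lincomb -/P -/Q => h.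
  have c0 : 0 < (l - 1) / l by rewrite divr_gt0//; lra.
  (* Young's weight [(l - 1) / l] gives [(K + l) (K + 1)] as coefficient of [P]. *)
  have := ip_young (p n.+2) (q n.+2) c0; rewrite -/P -/Q => y.
  have yK : 0 <= l * (K + l) *
      (2 * ip (p n.+2) (q n.+2) + ((l - 1) / l * P + ((l - 1) / l)^-1 * Q)).
    by rewrite mulr_ge0//; [rewrite mulr_ge0//; lra|lra].
  have yE : l * (K + l) *
      (2 * ip (p n.+2) (q n.+2) + ((l - 1) / l * P + ((l - 1) / l)^-1 * Q)) =
      2 * l * (K + l) * ip (p n.+2) (q n.+2) + (l - 1) * (K + l) * P
      + l ^+ 2 / (l - 1) * ((K + l) * Q).
    by field; apply/andP; split; apply: lt0r_neq0; lra.
  have D0 : 0 <= l ^+ 2 / (l - 1).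
    by rewrite divr_ge0// ?exprn_ge0//; lra.
  have w : 0 <= l ^+ 2 / (l - 1) * ((l - 1) * (K * Q)).
    rewrite mulr_ge0//; apply: mulr_ge0; first by lra.
    by rewrite mulr_ge0// ltW.
  have -> : C = l ^+ 2 / (l - 1) * l.
    by rewrite /C; field; apply: lt0r_neq0; lra.
  have -> : (K + 1) ^+ 2 * P / (K + 1) = (K + 1) * P.
    by field; apply: lt0r_neq0; lra.
  have l2 : 0 <= l ^+ 2 * Q by rewrite mulr_ge0// sqr_ge0.
  move: (l ^+ 2 / (l - 1)) D0 w yE => D D0 w yE.
  by rewrite yE in yK; lra.
- move=> cA cB; split; last first.
    suff -> : (fun n => n.+2%:R * `|p n.+2| ^+ 2) =
        (fun n => (n.+2%:R * `|p n.+2|) ^+ 2 / n.+2%:R) by [].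
    apply/funext => n.
    by rewrite exprMn mulrAC (expr2 n.+2%:R) mulfK// pnatr_eq0.
  rewrite -(cvg_shiftS (fun k => k%:R * `|p k|)).
  have -> : [sequence n.+1%:R * `|p n.+1|]_n =
      (fun n => Num.sqrt ((n.+1%:R * `|p n.+1|) ^+ 2)).
    by apply/funext => n; rewrite sqrtr_sqr ger0_norm// mulr_ge0.
  have := cvg_comp _ _ cA (@sqrt_continuous R 0).
  by rewrite sqrtr0.
Qed.
Lemma momentum_summable (l : R) (z u b : nat -> H) : 1 < l ->
  (forall k, `|z k - b k| <= `|z k|) ->
  (forall k, (0 < k)%N -> u k.+1 = z k.+1 - z k + b k) ->
  (forall k, (0 < k)%N ->
    (k%:R + l) *: u k.+1 + l *: (z k.+1 - z k) = k%:R *: u k) ->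
  cvgn (series (fun n => n.+2%:R * `|u n.+2| ^+ 2)).
Proof.
move=> l1 zb uE uS.
have d0 : 0 < l - 1 by lra.
have : cvgn (series (fun n => (2 * (l - 1)) * (n.+2%:R * `|u n.+2| ^+ 2))).
  apply: (@series_cvg_of_decrease _
      (fun n => `|n.+1%:R *: u n.+1 + l *: z n.+1| ^+ 2
                + l * (l - 1) * `|z n.+1| ^+ 2)) => n.
  - rewrite addr_ge0 ?exprn_ge0//; apply: mulr_ge0; rewrite ?exprn_ge0//.
    by apply: mulr_ge0; lra.
  - apply: mulr_ge0; first by lra.
    by rewrite mulr_ge0// exprn_ge0.
  (* The recursion expresses the old energy vector through the new [u] and [z], so that both
     energies expand in the same inner product. *)
  - have -> : n.+1%:R *: u n.+1 + l *: z n.+1 =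
        (n.+1%:R + l) *: u n.+2 + l *: z n.+2.
      by rewrite -uS// scalerBr -addrA subrK.
    have zu : `|1 *: z n.+2 + (- 1) *: u n.+2| ^+ 2 <= `|z n.+1| ^+ 2.
      rewrite ler_pXn2r ?nnegrE//.
      rewrite scale1r scaleN1r uE// opprD opprB addrA addrCA subrr addr0.
      exact: zb.
    move: zu; rewrite !sqnorm_lincomb (ipC (z n.+2)).
    have -> : n.+2%:R = n.+1%:R + 1 :> R by rewrite -natr1.
    have U0 : 0 <= `|u n.+2| ^+ 2 by rewrite exprn_ge0.
    move: (n.+1%:R) (`|u n.+2| ^+ 2) (`|z n.+2| ^+ 2) (`|z n.+1| ^+ 2)
      (ip _ _) U0 => K U Z Z0 I U0 zu.
    (* The weight [l * (l - 1)] of the energy is the one that cancels the terms in [I]; [h2] is the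
       surplus in [U] that remains. *)
    have h1 : 0 <= l * (l - 1) * (Z0 - (Z - 2 * I + U)).
      by rewrite mulr_ge0// ?mulr_ge0//; lra.
    have h2 : 0 <= (l - 1) * (2 * l - 1) * U by rewrite !mulr_ge0//; lra.
    lra.
move/(@is_cvg_seriesZ _ _ (2 * (l - 1))^-1).
have -> : (2 * (l - 1))^-1 *:
    (fun n => (2 * (l - 1)) * (n.+2%:R * `|u n.+2| ^+ 2)) =
    (fun n => n.+2%:R * `|u n.+2| ^+ 2).
  apply/funext => n; rewrite scalrfctE; apply: mulKf.
  by apply: lt0r_neq0; lra.
by [].
Qed.

End InnerProduct.

(** The relaxed operator is [(1 - s * theta) Id + s * theta F], a convex combination of nonexpansive
    maps. *)
Lemma averaged_relaxation (R : realType) (H : normedModType R)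
    (theta s : R) (T : H -> H) :
  0 < theta -> 0 < s -> s <= 1 / theta -> averaged theta T ->
  nonexpansive (fun x => x - s *: (x - T x)).
Proof.
move=> t0 s0; rewrite ler_pdivlMr// => st [F [neF TE]] x y.
have E w : w - s *: (w - T w) = (1 - s * theta) *: w + (s * theta) *: F w.
  have -> : w - T w = theta *: (w - F w).
    by rewrite TE scalerBl scale1r opprD opprB addrA (addrC w) subrK -scalerBr.
  by rewrite scalerA scalerBr opprB scalerBl scale1r addrA addrAC.
rewrite !E opprD addrACA -!scalerBr.
apply: le_trans (ler_normD _ _) _; rewrite 2!normrZ.
have st0 : 0 <= s * theta by rewrite mulr_ge0// ltW.
have st1 : 0 <= 1 - s * theta by rewrite subr_ge0.
rewrite (ger0_norm st0) (ger0_norm st1).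
have := ler_wpM2l st0 (neF x y); lra.
Qed.

Theorem theorem3p5 (R : realType) (H : completeNormedModType R)
    (ip : {dot H for idfun}) (hip : induces_norm ip)
    (theta : R) (htheta0 : 0 < theta) (htheta1 : theta <= 1)
    (T : H -> H) (hT : averaged theta T)
    (hfix : exists p : H, T p = p)
    (alpha : R) (halpha : 2 < alpha)
    (s : R) (hs0 : 0 < s) (hs1 : s <= 1 / theta)
    (x : nat -> H) (hx : fast_KM alpha s T x) :
  little_o_inv (fun k : nat => `|x k - x k.-1|) /\
  little_o_inv (fun k : nat => `|x k.-1 - T (x k.-1)|).
Proof.
have neS := averaged_relaxation htheta0 hs0 hs1 hT.
have [p Tp] := hfix.
have [l al] : exists l, alpha = 2 * l by exists (alpha / 2); field.
have l1 : 1 < l by lra.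
pose b k := s *: (x k - T (x k)).
pose v k := x k - x k.-1.
pose u k := v k + b k.-1.
have den k : k%:R + 2 * l != 0.
  by apply: lt0r_neq0; have : 0 <= k%:R :> R by []; lra.
have uS k : (0 < k)%N -> (k%:R + l) *: u k.+1 + l *: v k.+1 = k%:R *: u k.
  move=> k0; apply: (ip_inj hip) => w.
  rewrite /u /v /b /= (hx k k0) al.
  rewrite !(ipDl, ipNl, ipZl).
  by field; exact: den.
have vS k : (0 < k)%N -> (k%:R + l) *: v k.+1 + l *: u k.+1 =
    k%:R *: ((x k - b k) - (x k.-1 - b k.-1)).
  move=> k0; apply: (ip_inj hip) => w.
  rewrite /u /v /b /= (hx k k0) al.
  rewrite !(ipDl, ipNl, ipZl).
  by field; exact: den.
have su : cvgn (series (fun n => n.+2%:R * `|u n.+2| ^+ 2)).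
  apply: (@momentum_summable _ _ _ hip l (fun k => x k - p) u b l1) => k.
  (* A fixed point of [T] is also fixed by the relaxed operator. *)
  - have := neS (x k) p; rewrite /= Tp subrr scaler0 subr0.
    by rewrite addrAC.
  - by move=> k0; rewrite opprB addrA subrK.
  - by move=> k0; rewrite opprB addrA subrK -uS.
have [cv sv] : k%:R * `|v k| @[k --> \oo] --> (0 : R) /\
    cvgn (series (fun n => n.+2%:R * `|v n.+2| ^+ 2)).
  apply: (coupled_decay hip l1 _ su) => k k0.
  by rewrite vS// !normrZ ler_wpM2l// neS.
(* The roles are now exchanged: [v] is the summable perturbation, and [uS] gives the required bound
   with equality. *)
have [cu _] : k%:R * `|u k| @[k --> \oo] --> (0 : R) /\
    cvgn (series (fun n => n.+2%:R * `|u n.+2| ^+ 2)).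
  by apply: (coupled_decay hip l1 _ sv) => k k0; rewrite uS.
split; first exact: cv.
have c0 : s^-1 * (k%:R * `|u k| + k%:R * `|v k|) @[k --> \oo] --> (0 : R).
  have -> : (0 : R) = s^-1 * (0 + 0) by rewrite addr0 mulr0.
  by apply: cvgMr; apply: cvgD.
apply: (squeeze_cvgr _ (cvg_cst 0) c0); apply: nearW => k.
rewrite mulr_ge0//= -mulrDr mulrCA ler_wpM2l//.
rewrite ler_pdivlMl//.
have -> : s * `|x k.-1 - T (x k.-1)| = `|u k - v k|.
  by rewrite /u addrAC subrr add0r /b normrZ gtr0_norm.
exact: ler_normB.
Qed.
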